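(* For every odd positive integer $k \le 2 \cdot 10^{100}$, the equation $\phi(n+k) = 2\,\phi(n)$ has at least five distinct solutions $n$ in positive integers.
   Context: $\phi$ denotes Euler's Phi function: $\phi(n)$ is the number of positive integers less than or equal to $n$ that are coprime with $n$. Here $k$ is fixed and $n$ is the unknown. *)

(* Defs.v *)
From mathcomp Require Import all_boot.

(* Main.v *)
(** Solutions are sought in the form n = a (k/d), n + k = b (k/d), where d = b - a
    divides k and is coprime to a b.  Whether such an n solves the equation depends
    only on which prime factors of a b divide k.  If q is a prime not dividing k such
    that all odd prime factors of q - 1 divide k, then (a, b) = (q - 1, q) always works,
    and so do ((q - 1)/2, 2 q) for q = 3 mod 4, (q, 4 (q - 1)), and
    ((q - 1)(q' - 1), q q') for two such primes, provided d divides k; also (1, 4)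
    works when 3 | k.  Branching on whether q | k for successive primes q therefore
    ends either with five solutions or with a set of prime divisors of k whose product
    exceeds 2 * 10^100.  When neither 3 nor 5 divides k this would need large primes,
    but other pairs (a, b) then give five solutions after a few branchings, without
    using the bound on k. *)
From Stdlib Require Import NArith.
Require Import Defs.
From mathcomp Require Import all_boot.

Set Implicit Arguments.
Unset Strict Implicit.
Unset Printing Implicit Defensive.

(** * Candidate solutions *)

(** [(A, B, D)] lists the prime factors, with multiplicity, of a, b and d = b - a. *)
Definition cand := (seq N * seq N * seq N)%type.

Fixpoint prodN (l : seq N) : N :=
  if l is p :: l' then N.mul p (prodN l') else 1%num.

(** [totient (b m) = phi_factor S B * totient m] when [S] contains exactly those prime
    factors of b that divide m. *)
Fixpoint phi_factor (S l : seq N) : N :=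
  if l is p :: l' then
    N.mul (if (p \in S) || (p \in l') then p else N.pred p) (phi_factor S l')
  else 1%num.

(** [S] and [Q] are the primes known to divide, respectively not to divide, k. *)
Definition valid (S Q : seq N) (c : cand) : bool :=
  let: (A, B, D) := c in
  [&& all (mem S) D, uniq D,
      all (fun p => ((p \in S) || (p \in 2%num :: Q)) && (p \notin D)) (A ++ B),
      N.eqb (prodN B) (N.add (prodN A) (prodN D))
    & N.eqb (phi_factor S B) (N.mul 2 (phi_factor S A))].

(** Since n = a (k/d), comparing a/d with a'/d' by cross-multiplication separates the solutions
    whatever k is. *)
Definition distinct (c c' : cand) : bool :=
  let: (A, _, D) := c in let: (A', _, D') := c' in
  ~~ N.eqb (N.mul (prodN A) (prodN D')) (N.mul (prodN A') (prodN D)).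

Lemma to_natM (m n : N) : N.to_nat (N.mul m n) = N.to_nat m * N.to_nat n.
Proof. exact: N2Nat.inj_mul. Qed.

Lemma to_natX (m n : N) : N.to_nat (N.pow m n) = N.to_nat m ^ N.to_nat n.
Proof.
by rewrite N2Nat.inj_pow; elim: (N.to_nat n) => //= e ->; rewrite expnS.
Qed.

Lemma prime_dvd_prodN (p : N) (l : seq N) :
  prime (N.to_nat p) -> {in l, forall q, prime (N.to_nat q)} ->
  (N.to_nat p %| N.to_nat (prodN l)) = (p \in l).
Proof.
move=> p_pr; elim: l => [|q l IHl] l_pr; first by rewrite dvdn1; case: eqP p_pr => [->|].
have tl_pr : {in l, forall r, prime (N.to_nat r)}.
  by move=> r r_l; apply: l_pr; rewrite inE r_l orbT.
have q_pr := l_pr q (mem_head _ _).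
by rewrite /= to_natM Euclid_dvdM // inE dvdn_prime2 // IHl // (inj_eq N2Nat.inj).
Qed.

Lemma prodN_dvd (k : nat) (l : seq N) :
  uniq l -> {in l, forall p, prime (N.to_nat p) /\ N.to_nat p %| k} ->
  N.to_nat (prodN l) %| k.
Proof.
elim: l => [|p l IHl] //= /andP[p_l l_uniq] l_k.
have tl_k : {in l, forall q, prime (N.to_nat q) /\ N.to_nat q %| k}.
  by move=> q q_l; apply: l_k; rewrite inE q_l orbT.
have [p_pr p_k] := l_k p (mem_head _ _).
rewrite to_natM Gauss_dvd ?p_k ?IHl // prime_coprime // prime_dvd_prodN //.
by move=> q /tl_k[].
Qed.

Lemma totient_mull (p m : nat) :
  prime p -> totient (p * m) = (if p %| m then p else p.-1) * totient m.
Proof.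
move=> p_pr; have [->|m_gt0] := posnP m; first by rewrite muln0 muln0.
case: ifPn => [p_m|]; last first.
  by rewrite -prime_coprime // => co; rewrite totient_coprime // totient_prime.
have e_gt0: 0 < logn p m by rewrite logn_gt0 mem_primes p_pr m_gt0.
have [r co ->] := pfactor_coprime p_pr m_gt0.
have co_r e : coprime r (p ^ e) by rewrite coprime_sym coprimeXl.
rewrite mulnCA -expnS !totient_coprime // !totient_pfactor //=.
by case: (logn p m) e_gt0 => //= e _; rewrite expnS (mulnCA p.-1) mulnCA.
Qed.

Lemma totient_prodN (S l : seq N) (m : nat) :
  {in l, forall p, prime (N.to_nat p) /\ (p \in S) = (N.to_nat p %| m)} ->
  totient (N.to_nat (prodN l) * m) = N.to_nat (phi_factor S l) * totient m.
Proof.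
elim: l => [|p l IHl] l_m; first by rewrite /= !mul1n.
have tl_m : {in l, forall p, prime (N.to_nat p) /\ (p \in S) = (N.to_nat p %| m)}.
  by move=> q q_l; apply: l_m; rewrite inE q_l orbT.
have [p_pr p_S] := l_m p (mem_head _ _).
rewrite /= !to_natM -!mulnA totient_mull // IHl // p_S Euclid_dvdM // orbC.
rewrite prime_dvd_prodN => // [|q /tl_m[] //].
by congr muln; case: ifP => // _; rewrite N2Nat.inj_pred.
Qed.

Definition decided (k : nat) (S Q : seq N) : Prop :=
  {in S, forall p, prime (N.to_nat p) /\ N.to_nat p %| k} /\
  {in Q, forall q, prime (N.to_nat q) /\ ~~ (N.to_nat q %| k)}.

Definition solution (k : nat) (c : cand) : nat :=
  N.to_nat (prodN c.1.1) * (k %/ N.to_nat (prodN c.2)).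

Definition sound (k : nat) (c : cand) : Prop :=
  [/\ N.to_nat (prodN c.2) %| k, 0 < solution k c
    & totient (solution k c + k) = 2 * totient (solution k c)].

(** Put m = k/d, so that n = a m and n + k = b m. A prime of a b in [S] divides k but not d, hence
    divides m; any other one is 2 or lies in [Q], hence does not divide m. *)
Lemma valid_sound (k : nat) (S Q : seq N) (c : cand) :
  odd k -> decided k S Q -> valid S Q c -> sound k c.
Proof.
move=> k_odd [S_k Q_k]; case: c => [[A B] D].
case/and5P=> /allP D_S D_uniq /allP AB_S /N.eqb_eq B_AD /N.eqb_eq phiB.
have D_k : {in D, forall p, prime (N.to_nat p) /\ N.to_nat p %| k}.
  by move=> p /D_S /S_k.
have d_k := prodN_dvd D_uniq D_k.
rewrite /sound /solution /=; set d := N.to_nat (prodN D) in d_k *.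
set m := k %/ d; have k_dm : k = d * m by rewrite mulnC divnK.
have AB_m : {in A ++ B, forall p, prime (N.to_nat p) /\ (p \in S) = (N.to_nat p %| m)}.
  move=> p /AB_S /andP[p_SQ p_D].
  have [p_S|p_S] := boolP (p \in S).
    have [p_pr p_k] := S_k p p_S; split=> //; move: p_k.
    rewrite k_dm Euclid_dvdM // prime_dvd_prodN // => [|q /D_k[] //].
    by rewrite (negPf p_D) /= => ->.
  suff [p_pr p_k] : prime (N.to_nat p) /\ ~~ (N.to_nat p %| k).
    split=> //; apply/esym/negbTE; apply: contra p_k => p_m.
    by rewrite k_dm dvdn_mull.
  move: p_SQ; rewrite (negPf p_S) inE /= => /orP[/eqP-> |/Q_k //].
  by rewrite dvdn2 k_odd.
have A_m : {in A, forall p, prime (N.to_nat p) /\ (p \in S) = (N.to_nat p %| m)}.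
  by move=> p p_A; apply: AB_m; rewrite mem_cat p_A.
have B_m : {in B, forall p, prime (N.to_nat p) /\ (p \in S) = (N.to_nat p %| m)}.
  by move=> p p_B; apply: AB_m; rewrite mem_cat p_B orbT.
have -> : N.to_nat (prodN A) * m + k = N.to_nat (prodN B) * m.
  by rewrite B_AD N2Nat.inj_add mulnDl -k_dm.
split=> //; last by rewrite (totient_prodN A_m) (totient_prodN B_m) phiB to_natM mulnA.
have m_gt0: 0 < m by case: (posnP m) k_odd => // m0; rewrite k_dm m0 muln0.
rewrite muln_gt0 m_gt0 andbT.
elim: A {AB_S B_AD phiB AB_m} A_m => //= p A IHA A_m.
rewrite to_natM muln_gt0 prime_gt0 ?IHA //; last by case: (A_m p (mem_head _ _)).
by move=> q q_A; apply: A_m; rewrite inE q_A orbT.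
Qed.

Definition five_solutions (k : nat) : Prop :=
  exists s : seq nat,
    [/\ uniq s, 5 <= size s
      & forall n : nat, n \in s -> 0 < n /\ totient (n + k) = 2 * totient n].

Definition admissible (k : nat) (done : seq cand) : Prop :=
  (forall c, c \in done -> sound k c) /\ pairwise distinct done.

Lemma distinct_solution (k : nat) (c c' : cand) :
  0 < k -> sound k c -> sound k c' -> distinct c c' ->
  solution k c != solution k c'.
Proof.
case: c c' => [[A B] D] [[A' B'] D'] k_gt0 [d_k _ _] [d'_k _ _].
rewrite /distinct /solution /= in d_k d'_k *; apply: contra => /eqP eqn.
apply/N.eqb_eq/N2Nat.inj; rewrite !to_natM; apply/eqP.
(* Multiply by k, written as (k/d) d on one side and (k/d') d' on the other. *)
rewrite -(eqn_pmul2r k_gt0) -{1}(divnK d_k) -[X in _ == _ * X](divnK d'_k).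
by rewrite !(mulnACA _ _ (k %/ _)) eqn [X in _ * X]mulnC.
Qed.

Lemma admissible_five (k : nat) (done : seq cand) :
  0 < k -> admissible k done -> 4 < size done -> five_solutions k.
Proof.
move=> k_gt0 [done_k done_uniq] size_done.
exists (map (solution k) done); split; last 2 first.
- by rewrite size_map.
- by move=> n /mapP[c /done_k[_ ? ?] ->].
rewrite {size_done}.
elim: done done_k done_uniq => //= c done IHd done_k /andP[c_done d_uniq].
rewrite IHd ?andbT // => [|c' c'_d]; last by apply: done_k; rewrite inE c'_d orbT.
apply/mapP=> -[c' c'_d /eqP]; apply/negP; apply: distinct_solution => //.
- by apply: done_k; rewrite mem_head.
- by apply: done_k; rewrite inE c'_d orbT.
- exact: (allP c_done).
Qed.

(** * The search *)

(** A candidate with a prime of d in [Q] is dropped for good: d can no longer divide k. *)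
Fixpoint settle (S Q : seq N) (todo done : seq cand) : seq cand * seq cand :=
  if todo is c :: todo' then
    let: (wait, done') := settle S Q todo' done in
    if valid S Q c && all (distinct c) done' then (wait, c :: done')
    else (if has (mem Q) c.2 then wait else c :: wait, done')
  else ([::], done).

(** The factorizations are only hints, as [valid] checks them again: hence the
    arbitrary fuel. *)
Fixpoint trial_division (fuel : nat) (n d : N) : seq N :=
  if fuel is fuel'.+1 then
    if N.ltb n (N.mul d d) then if N.eqb n 1 then [::] else [:: n]
    else let: (q, r) := N.div_eucl n d in
      if N.eqb r 0 then d :: trial_division fuel' q d
      else trial_division fuel' n (N.succ d)
  else [::].

Definition factor (n : N) : seq N := trial_division 100 n 2.

Definition mk_cand (A B : seq N) : cand :=
  (A, B, factor (N.sub (prodN B) (prodN A))).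

(** [(p, f, cs)]: a prime p, the prime factors of p - 1, and candidates to be tried
    when p does not divide k. *)
Definition row := (N * seq N * seq cand)%type.

(** [P] is the product of [S], and [Q] pairs each prime q known not to divide k with the
    prime factors of q - 1.  A prime p such that some odd prime factor of p - 1 is
    not known to divide k is skipped. *)
Fixpoint search (bound : N) (rows : seq row) (S : seq N) (P : N)
    (Q : seq (N * seq N)) (todo done : seq cand) : bool :=
  if (4 < size done) || N.ltb bound P then true else
  if rows is (p, f, cs) :: rows' then
    if all (fun x => (x \in S) || (N.eqb x 2)) f then
      let Q0 := unzip1 Q in
      [&& p \notin S,
          let: (todo1, done1) := settle (p :: S) Q0 todo done in
          search bound rows' (p :: S) (N.mul p P) Q todo1 done1
        & let new := [seq mk_cand (f ++ q.2) [:: p; q.1] | q <- Q] in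
          let: (todo2, done2) := settle S (p :: Q0) (cs ++ new ++ todo) done in
          search bound rows' S P ((p, f) :: Q) todo2 done2]
    else search bound rows' S P Q todo done
  else false.

Lemma settle_admissible (k : nat) (S Q : seq N) (todo done : seq cand) :
  odd k -> decided k S Q -> admissible k done ->
  admissible k (settle S Q todo done).2.
Proof.
move=> k_odd SQ_k done_k; elim: todo => //= c todo.
case: (settle S Q todo done) => [wait done1] /= [done1_k done1_uniq].
case: ifP => // /andP[c_valid c_done1]; split=> /=; last by rewrite c_done1.
move=> c'; rewrite inE => /predU1P[-> |/done1_k //].
exact: valid_sound c_valid.
Qed.

Lemma decided_consl (k : nat) (p : N) (S Q : seq N) :
  prime (N.to_nat p) -> N.to_nat p %| k -> decided k S Q -> decided k (p :: S) Q.
Proof.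
by move=> p_pr p_k [S_k Q_k]; split=> // q; rewrite inE => /predU1P[-> |/S_k].
Qed.

Lemma decided_consr (k : nat) (p : N) (S Q : seq N) :
  prime (N.to_nat p) -> ~~ (N.to_nat p %| k) -> decided k S Q -> decided k S (p :: Q).
Proof.
by move=> p_pr p_k [S_k Q_k]; split=> // q; rewrite inE => /predU1P[-> |/Q_k].
Qed.

Lemma search_sound (k : nat) (bound : N) (rows : seq row) (S : seq N) (P : N)
    (Q : seq (N * seq N)) (todo done : seq cand) :
  odd k -> k <= N.to_nat bound -> {in rows, forall r, prime (N.to_nat r.1.1)} ->
  P = prodN S -> uniq S -> decided k S (unzip1 Q) -> admissible k done ->
  search bound rows S P Q todo done -> five_solutions k.
Proof.
move=> k_odd k_le.
(* At a leaf the product of [S'] divides k, so it cannot exceed the bound. *)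
have base S' Q' P' (done' : seq cand) :
    P' = prodN S' -> uniq S' -> decided k S' Q' -> admissible k done' ->
    (4 < size done') || N.ltb bound P' -> five_solutions k.
- move=> -> S_uniq [S_k _] done_k /orP[size_done|/N.ltb_lt P_big].
    exact: admissible_five (odd_gt0 k_odd) done_k size_done.
  have := dvdn_leq (odd_gt0 k_odd) (prodN_dvd S_uniq S_k).
  move/leq_trans/(_ k_le)/leP => P_le; case/N.lt_nge: P_big.
  by rewrite /N.le N2Nat.inj_compare; apply/PeanoNat.Nat.compare_le_iff.
elim: rows S P Q todo done => [|[[p f] cs] rows IHr] S P Q todo done
  rows_pr P_S S_uniq SQ_k done_k /=.
  by case: ifP => // leaf _; apply: base P_S S_uniq SQ_k done_k leaf.
case: ifP => [leaf _|_]; first exact: base P_S S_uniq SQ_k done_k leaf.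
have p_pr : prime (N.to_nat p) := rows_pr (p, f, cs) (mem_head _ _).
have {}rows_pr : {in rows, forall r, prime (N.to_nat r.1.1)}.
  by move=> r r_rows; apply: rows_pr; rewrite inE r_rows orbT.
case: ifP => [_|_]; last exact: IHr.
case/and3P=> p_S.
have [p_k|p_k] := boolP (N.to_nat p %| k).
- have pS_k := decided_consl p_pr p_k SQ_k.
  have := settle_admissible todo k_odd pS_k done_k.
  case: settle => [todo1 done1] /= done1_k search1 _.
  by apply: IHr search1 => //=; rewrite ?P_S // p_S.
- have pQ_k := decided_consr p_pr p_k SQ_k.
  set todo' := _ ++ _; have := settle_admissible todo' k_odd pQ_k done_k.
  case: settle => [todo2 done2] /= done2_k _ search2.
  exact: IHr search2.
Qed.

(** * Computation *)

(** [behead f] drops one factor 2, as [factor] lists the smallest prime first. *)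
Definition single_cands (q : N) : seq cand :=
  let f := factor (N.pred q) in
  [:: mk_cand f [:: q]; mk_cand [:: q] [:: 2, 2 & f]%num]
    ++ (if N.eqb (N.modulo q 4) 3 then
          [:: mk_cand (behead f) [:: 2; q]%num] else [::]).

Definition table : seq row := Eval vm_compute in
  [seq (let q := N.of_nat p in (q, factor (N.pred q), single_cands q))
     | p <- iota 7 3203 & prime p].

Definition kmax : N := N.mul 2 (N.pow 10 100).

(** The empty factor lists make [search] branch on every prime. *)
Definition table15 : seq row :=
  [seq (p, [::], [::]) | p <- [:: 7; 17; 13; 19; 109; 257; 241; 73]%num].

(** Pairs (a, b) found by a computer search. *)
Definition cands15 : seq cand :=
  [seq mk_cand (factor c.1) (factor c.2) | c <-
   [:: (2, 3); (4, 5); (3, 10); (8, 15); (15, 32); (16, 17); (5, 24); (9, 28);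
       (28, 45); (648, 665); (15, 34); (35, 144); (51, 160); (140, 153);
       (532, 545); (65, 306); (255, 512); (225, 482); (39, 112); (256, 257);
       (2240, 2313); (364, 365)]%num].

Lemma to_nat_kmax : N.to_nat kmax = 2 * 10 ^ 100.
Proof.
(* Only these literals are converted by computation: 10 ^ 100 is out of reach in unary. *)
have digits : (N.to_nat 2 = 2) * (N.to_nat 10 = 10) * (N.to_nat 100 = 100) by [].
by rewrite /kmax to_natM to_natX !digits.
Qed.

Lemma table_prime : {in table, forall r, prime (N.to_nat r.1.1)}.
Proof. by apply/allP; vm_compute. Qed.

Lemma table15_prime : {in table15, forall r, prime (N.to_nat r.1.1)}.
Proof. by apply/allP; vm_compute. Qed.

Lemma search3 :
  search kmax ((5, [:: 2; 2], single_cands 5)%num :: table)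
    [:: 3]%num 3 [::] [:: mk_cand [::] [:: 2; 2]]%num [::].
Proof. by vm_compute. Qed.

(** The initial candidates are (2, 3), (3, 8) and (1, 6), available as 3 does not divide k. *)
Lemma search5 :
  search kmax table [:: 5]%num 5 [:: (3, [:: 2])]%num (single_cands 3) [::].
Proof. by vm_compute. Qed.

(** The primes of [table15] have a product far below [kmax], so every leaf has five solutions. *)
Lemma search15 :
  search kmax table15 [::] 1 [:: (5, [::]); (3, [::])]%num cands15 [::].
Proof. by vm_compute. Qed.

Theorem theorem3 (k : nat) (k_odd : odd k) (k_le : k <= 2 * 10 ^ 100) :
  exists s : seq nat,
    [/\ uniq s, 5 <= size s
      & forall n : nat, n \in s -> 0 < n /\ totient (n + k) = 2 * totient n].
Proof.
rewrite -to_nat_kmax in k_le.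
have none : decided k [::] [::] by [].
have [k3|k3] := boolP (N.to_nat 3 %| k).
  apply: search_sound k_odd k_le _ _ _ _ _ search3 => //.
    by move=> r; rewrite inE => /predU1P[-> |/table_prime].
  exact: decided_consl.
have [k5|k5] := boolP (N.to_nat 5 %| k).
  apply: search_sound k_odd k_le table_prime _ _ _ _ search5 => //.
  by apply: decided_consl => //; apply: decided_consr.
apply: search_sound k_odd k_le table15_prime _ _ _ _ search15 => //.
by do 2!apply: decided_consr => //.
Qed.
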